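(* Let $D$ be a finite simple digraph of order $n \geq 3$. Then $\gamma_I(D)=2$ if and only if either $\Delta^+(D)=n-1$, or there exist two distinct vertices $u$ and $v$ of $D$ such that $V(D)\setminus\{u,v\}\subseteq N_D^+(u)$ and $V(D)\setminus\{u,v\}\subseteq N_D^+(v)$.
   Context: A finite simple digraph has no loops and no multiple arcs (oppositely oriented arcs allowed). $N_D^+(v)$ is the set of out-neighbors of $v$ and $\Delta^+(D)$ the maximum out-degree. An Italian dominating function (IDF) on $D$ is a function $f:V(D)\to\{0,1,2\}$ such that every vertex $v$ with $f(v)=0$ has at least two in-neighbors $w$ with $f(w)=1$ or at least one in-neighbor $w$ with $f(w)=2$. Its weight is $\sum_{u\in V(D)}f(u)$, and $\gamma_I(D)$ is the minimum weight of an IDF on $D$. *)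

(* Defs.v *)
From mathcomp Require Import all_boot.
Set Implicit Arguments.
Unset Strict Implicit.
Unset Printing Implicit Defensive.

(* A finite simple digraph is an irreflexive [e : rel T] on [T : finType], with
   [e u v] meaning that there is an arc from [u] to [v].  Multiple arcs are
   excluded because [e] is a relation; opposite arcs are allowed since [e] is
   not required to be antisymmetric. *)

Section ItalianDomination.
Variables (T : finType) (e : rel T).

Definition out_nbrs (v : T) : {set T} := [set w | e v w].
Definition in_nbrs (v : T) : {set T} := [set w | e w v].

Definition max_outdeg : nat := \max_(v : T) #|out_nbrs v|.

Definition is_IDF (f : {ffun T -> 'I_3}) : bool :=
  [forall v, (f v == 0 :> nat) ==>
     (2 <= #|[set w in in_nbrs v | f w == 1 :> nat]|)
  || (1 <= #|[set w in in_nbrs v | f w == 2 :> nat]|)].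

Definition weight (f : {ffun T -> 'I_3}) : nat := \sum_(u : T) f u.

Definition const2 : {ffun T -> 'I_3} := [ffun=> ord_max].

(* [const2] is an IDF (see [const2_IDF]), so this is a genuine minimum. *)
Definition gamma_I : nat := weight [arg min_(f < const2 | is_IDF f) weight f].

Lemma const2_IDF : is_IDF const2.
Proof. by apply/forallP => v; rewrite ffunE. Qed.

Lemma gamma_I_min :
  (exists2 f, is_IDF f & weight f = gamma_I)
  /\ (forall f, is_IDF f -> gamma_I <= weight f).
Proof.
rewrite /gamma_I; case: arg_minnP => [|f fI fmin]; first exact: const2_IDF.
by split=> //; exists f.
Qed.

End ItalianDomination.

(* Main.v *)
Require Import Defs.
From mathcomp Require Import all_boot.

(** With at least two vertices every IDF has weight at least 2 ([IDF_weight_ge2]), so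
    [gamma_I e = 2] just says that an IDF of weight 2 exists. Weight 2 can be spread in only two
    ways: a single 2 at [u], which is an IDF exactly when [u] dominates every other vertex, or a 1
    at each of two vertices [u] and [v], which is an IDF exactly when both dominate every remaining
    vertex. [dominating_of_IDF_weight2] extracts these configurations, and the two
    [IDF_weight2_of_dominating] lemmas build the functions back. In a loopless digraph the first
    configuration is the degree condition, by [max_outdeg_eqP]. *)

Lemma is_IDFP (T : finType) (e : rel T) (f : {ffun T -> 'I_3}) :
  reflect (forall v, f v = 0 :> nat ->
             (exists w1 w2, [/\ w1 != w2, e w1 v, e w2 v,
                                f w1 = 1 :> nat & f w2 = 1 :> nat])
             \/ (exists2 w, e w v & f w = 2 :> nat))
          (is_IDF e f).
Proof.
apply: (iffP forallP) => [fI v /eqP fv0 | fI v].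
  have /implyP/(_ fv0)/orP[/card_gt1P[w1 [w2 [+ + ne]]] | /card_gt0P[w]] := fI v.
    rewrite !inE => /andP[ew1 /eqP f1] /andP[ew2 /eqP f2].
    by left; exists w1, w2.
  by rewrite !inE => /andP[ew /eqP fw]; right; exists w.
apply/implyP => /eqP/fI[[w1 [w2 [ne ew1 ew2 f1 f2]]] | [w ew fw]]; apply/orP.
  by left; apply/card_gt1P; exists w1, w2; rewrite !inE ew1 ew2 f1 f2.
by right; apply/card_gt0P; exists w; rewrite !inE ew fw.
Qed.

Lemma leq_weight1 (T : finType) (f : {ffun T -> 'I_3}) u : f u <= weight f.
Proof. by rewrite /weight (bigD1 u) //= leq_addr. Qed.

Lemma leq_weight2 (T : finType) (f : {ffun T -> 'I_3}) u v :
  u != v -> f u + f v <= weight f.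
Proof.
move=> uv; rewrite /weight (bigD1 u) //= leq_add2l (bigD1 v) /= ?leq_addr //.
by rewrite eq_sym.
Qed.

Lemma leq_weight3 (T : finType) (f : {ffun T -> 'I_3}) u v w :
  u != v -> w \notin [set u; v] -> f u + f v + f w <= weight f.
Proof.
rewrite !inE negb_or => uv /andP[wu wv].
rewrite /weight (bigD1 u) //= (bigD1 v) /=; last by rewrite eq_sym.
by rewrite (bigD1 w) /= ?wu ?wv // -!addnA !leq_add2l leq_addr.
Qed.

(** A vertex of value 0 has in-neighbors of total value at least 2; if there is no such vertex, each
    vertex contributes at least 1. *)
Lemma IDF_weight_ge2 (T : finType) (e : rel T) (f : {ffun T -> 'I_3}) :
  1 < #|T| -> is_IDF e f -> 2 <= weight f.
Proof.
move=> T_gt1 /is_IDFP fI.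
have [/existsP[v /eqP/fI] | /existsPn fpos] := boolP [exists v, f v == 0 :> nat].
  case=> [[w1 [w2 [ne _ _ f1 f2]]] | [w _ fw]].
    by have := leq_weight2 _ f _ _ ne; rewrite f1 f2.
  by have := leq_weight1 _ f w; rewrite fw.
apply: leq_trans T_gt1 _; rewrite -sum1_card.
by apply: leq_sum => v _; rewrite lt0n.
Qed.

Lemma gamma_I_eq2P (T : finType) (e : rel T) : 1 < #|T| ->
  gamma_I e = 2 <-> exists2 f, is_IDF e f & weight f = 2.
Proof.
move=> T_gt1; have [[g gI gw] gmin] := gamma_I_min e.
split=> [g2 | [f fI f2]]; first by exists g; rewrite // gw.
apply/eqP; rewrite eqn_leq; apply/andP; split; first by rewrite -f2 gmin.
by rewrite -gw; apply: IDF_weight_ge2 gI.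
Qed.

(** Without loops an out-neighborhood lies in the complement of its vertex, which has [#|T| - 1]
    elements, so reaching that size forces equality. *)
Lemma max_outdeg_eqP (T : finType) (e : rel T) :
  irreflexive e -> 0 < #|T| ->
  max_outdeg e = #|T| - 1 <-> exists u, ~: [set u] \subset out_nbrs e u.
Proof.
move=> e_irr T_gt0.
have cC (u : T) : #|~: [set u]| = #|T| - 1 by rewrite cardsC1 subn1.
have sub u : out_nbrs e u \subset ~: [set u].
  by apply/subsetP => w; rewrite !inE; apply: contraTneq => ->; rewrite e_irr.
split=> [dmax | [u su]].
  have [u du] := eq_bigmax (fun v => #|out_nbrs e v|) T_gt0.
  exists u; suff /eqP-> : out_nbrs e u == ~: [set u] by [].
  by rewrite eqEcard sub cC -dmax /max_outdeg du leqnn.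
apply/eqP; rewrite eqn_leq; apply/andP; split.
  by apply/bigmax_leqP => v _; rewrite -(cC v) subset_leq_card.
rewrite -(cC u); apply: leq_trans (subset_leq_card su) _.
exact: (leq_bigmax (F := fun v => #|out_nbrs e v|) u).
Qed.

Lemma IDF_weight2_of_dominating (T : finType) (e : rel T) u :
  ~: [set u] \subset out_nbrs e u -> exists2 f, is_IDF e f & weight f = 2.
Proof.
move=> /subsetP su; exists [ffun x => if x == u then inord 2 else ord0].
  apply/is_IDFP => v; rewrite ffunE; case: eqP => [_ | /eqP vu _].
    by rewrite inordK.
  right; exists u; last by rewrite ffunE eqxx inordK.
  by have := su v; rewrite !inE; apply.
rewrite /weight (bigD1 u) //= ffunE eqxx inordK // big1 // => v vu.
by rewrite ffunE (negPf vu).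
Qed.

Lemma IDF_weight2_of_dominating_pair (T : finType) (e : rel T) u v :
  u != v -> ~: [set u; v] \subset out_nbrs e u ->
  ~: [set u; v] \subset out_nbrs e v -> exists2 f, is_IDF e f & weight f = 2.
Proof.
move=> uv /subsetP su /subsetP sv.
exists [ffun x => if x \in [set u; v] then inord 1 else ord0].
  apply/is_IDFP => w; rewrite ffunE; case: ifPn => [_ | wuv _].
    by rewrite inordK.
  left; exists u, v; rewrite !ffunE set21 set22 inordK //.
  by have := su w; have := sv w; rewrite in_setC wuv !inE => -> // ->.
rewrite /weight (bigD1 u) //= (bigD1 v) /=; last by rewrite eq_sym.
rewrite !ffunE set21 set22 inordK // big1 // => w /andP[wu wv].
by rewrite ffunE !inE (negPf wu) (negPf wv).
Qed.

Lemma dominating_of_IDF_weight2 (T : finType) (e : rel T) f :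
  is_IDF e f -> weight f = 2 ->
  (exists u, ~: [set u] \subset out_nbrs e u)
  \/ (exists u v, [/\ u != v, ~: [set u; v] \subset out_nbrs e u
                    & ~: [set u; v] \subset out_nbrs e v]).
Proof.
move=> /is_IDFP fI f2.
have [/existsP[u /eqP fu] | /existsPn no2] := boolP [exists u, f u == 2 :> nat].
  (* The value 2 at [u] uses up the whole weight. *)
  have f0 w : w != u -> f w = 0 :> nat.
    by move=> /(leq_weight2 _ f); rewrite f2 fu addn2 !ltnS leqn0 => /eqP.
  have only w : 0 < f w -> w = u.
    by apply: contraTeq => /f0 ->.
  left; exists u; apply/subsetP => w; rewrite !inE => /f0/fI.
  case=> [[w1 [w2 [ne _ _ f1 f1']]] | [x ex fx]].
    (* Two distinct vertices of value 1 are impossible, since only [u] has a positive value. *)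
    by case/eqP: ne; rewrite (only w1) ?f1 // (only w2) ?f1'.
  by rewrite -(only x) ?fx.
have f_le1 w : f w <= 1.
  by have := ltn_ord (f w); rewrite ltnS leq_eqVlt (negPf (no2 w)).
have [u fu] : exists u, f u = 1 :> nat.
  have : weight f != 0 by rewrite f2.
  rewrite /weight sum_nat_eq0 => /forallPn[u] /=.
  by move=> fu; exists u; apply/eqP; rewrite eqn_leq f_le1 lt0n.
have [v vu fv] : exists2 v, v != u & f v = 1 :> nat.
  (* Away from [u] a weight of 1 is left, so some other vertex is positive. *)
  have : \sum_(w | w != u) f w != 0.
    by move: f2; rewrite /weight (bigD1 u) //= fu add1n => -[->].
  rewrite sum_nat_eq0 => /forallPn[v]; rewrite negb_imply => /andP[vu fv].
  by exists v => //; apply/eqP; rewrite eqn_leq f_le1 lt0n.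
have uv : u != v by rewrite eq_sym.
have f0 w : w \notin [set u; v] -> f w = 0 :> nat.
  by move=> /(leq_weight3 _ f _ _ _ uv); rewrite f2 fu fv !ltnS leqn0 => /eqP.
have only w : f w = 1 :> nat -> w = u \/ w = v.
  by move=> fw; apply/set2P; apply: contra_eqT fw => /f0 ->.
have dom w : w \notin [set u; v] -> e u w && e v w.
  move=> /f0/fI[[w1 [w2 [ne e1 e2 /only w1E /only w2E]]] | [x _ /eqP fx]]; last first.
    by case/negP: (no2 x).
  (* Being distinct and both in [[set u; v]], [w1] and [w2] are [u] and [v] in some order, so both
     arcs into [w] are present. *)
  by case: w1E w2E ne e1 e2 => -> [] ->; rewrite ?eqxx // => _ -> ->.
by right; exists u, v; split=> //; apply/subsetP => w;
  rewrite inE => /dom/andP[? ?]; rewrite inE.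
Qed.

Theorem theorem2p4 (T : finType) (e : rel T) (e_irr : irreflexive e)
    (n : nat) (card_T : #|T| = n) (n_ge3 : 3 <= n) :
  gamma_I e = 2 <->
    (max_outdeg e = n - 1
     \/ exists u v : T,
          [/\ u != v,
              ~: [set u; v] \subset out_nbrs e u
            & ~: [set u; v] \subset out_nbrs e v]).
Proof.
subst n; have T_gt1 := ltnW n_ge3; have T_gt0 := ltnW T_gt1.
split=> [/(gamma_I_eq2P _ _ T_gt1)[f fI f2] | dom].
  have [dom1 | dom2] := dominating_of_IDF_weight2 _ _ _ fI f2; last by right.
  by left; apply/max_outdeg_eqP.
apply/(gamma_I_eq2P _ _ T_gt1).
case: dom => [/(max_outdeg_eqP _ _ e_irr T_gt0)[u su] | [u [v [uv su sv]]]].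
  exact: IDF_weight2_of_dominating su.
exact: IDF_weight2_of_dominating_pair uv su sv.
Qed.
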